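(* Suppose $(\Omega,\nu,T)$ is uniquely ergodic and let $\rho(E)$ denote the fibered rotation number of $(T,A^E)$. Then: (1) for every $E>\sup f_{22}$, $\mathrm n(E)=1-\rho(E)$; (2) for every $E<\inf f_{22}$, $\mathrm n(E)=\frac12-\rho(E)$.
   Context: $\Omega$ is a compact metric space, $T:\Omega\to\Omega$ a homeomorphism with unique invariant Borel probability measure $\nu$, and $f=(f_{ij}):\Omega\to M(2,\mathbb C)$ is continuous with $f(\omega)$ self-adjoint; it is assumed that for $\nu$-a.e. $\omega$ one has $f_{12}(T^i\omega)\neq0$ for all $i$ and $f_{22}(T^i\omega)\neq f_{22}(T^j\omega)$ for $i\ne j$. Put $V_\omega(n)=f(T^n\omega)$, $J=\begin{pmatrix}1&0\\0&0\end{pmatrix}$ and $(\mathcal S_\omega\boldsymbol u)(n)=J\boldsymbol u(n+1)+J\boldsymbol u(n-1)+V_\omega(n)\boldsymbol u(n)$ on $\ell^2(\mathbb Z,\mathbb C^2)$. The integrated density of states is $\mathrm n(E)=\lim_{N\to\infty}\frac1{2N}\#\{\text{eigenvalues}\le E\text{ of }\mathcal S_\omega|_{[1,N]}\}$ (limit for a.e. $\omega$, independent of $\omega$), where $\mathcal S_\omega|_{[1,N]}$ is the $2N\times2N$ block tridiagonal matrix with diagonal blocks $V_\omega(1),\dots,V_\omega(N)$ and off-diagonal blocks $J$. For real $E\notin[\inf f_{22},\sup f_{22}]$, $A^E(\omega)=\begin{pmatrix}E-f_{11}(\omega)-\frac{|f_{12}(\omega)|^2}{E-f_{22}(\omega)}&-1\\1&0\end{pmatrix}\in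 SL(2,\mathbb R)$ is continuous in $\omega$, and $\rho(E)$ is the fibered rotation number of the cocycle $(\omega,v)\mapsto(T\omega,A^E(\omega)v)$, normalized as for Schrödinger cocycles (so that for $\begin{pmatrix}E-v&-1\\1&0\end{pmatrix}$ the integrated density of states equals $1-2\rho$); in particular $\rho(E)\to1/2$ as $E\to-\infty$ and $\rho(E)\to0$ as $E\to+\infty$. *)

(* Defs.v *)
From HB Require Import structures.
From mathcomp Require Import all_boot all_order all_algebra.
From mathcomp Require Import all_classical all_reals all_analysis.
From mathcomp Require Import complex.
Set Implicit Arguments. Unset Strict Implicit. Unset Printing Implicit Defensive.
Import Order.TTheory GRing.Theory Num.Theory.
Import numFieldNormedType.Exports.
Local Open Scope ring_scope.
Local Open Scope classical_set_scope.

Definition borel (Om : ptopologicalType) := g_sigma_algebraType (@open Om).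

Definition T_invariant {R : realType} {Om : ptopologicalType}
  (T : Om -> Om) (mu : probability (borel Om) R) : Prop :=
  forall A : set (borel Om), measurable A -> mu (T @^-1` A) = mu A.

Definition uniquely_ergodic {R : realType} {Om : ptopologicalType}
  (T : Om -> Om) (nu : probability (borel Om) R) : Prop :=
  T_invariant T nu /\
  forall mu : probability (borel Om) R, T_invariant T mu ->
    forall A : set (borel Om), measurable A -> mu A = nu A.

Definition Tpow {Om : Type} (T Tinv : Om -> Om) (k : int) (w : Om) : Om :=
  match k with
  | Posz n => iter n T w
  | Negz n => iter n.+1 Tinv w
  end.

Definition f11 {R : realType} {Om : Type} (f : Om -> 'M[R[i]]_2) (w : Om) : R :=
  complex.Re (f w 0 0).
Definition f22 {R : realType} {Om : Type} (f : Om -> 'M[R[i]]_2) (w : Om) : R :=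
  complex.Re (f w 1 1).
Definition f12 {R : realType} {Om : Type} (f : Om -> 'M[R[i]]_2) (w : Om) : R[i] :=
  f w 0 1.

Definition abs2 {R : realType} (z : R[i]) : R :=
  complex.Re z ^+ 2 + complex.Im z ^+ 2.

(* The restriction S_omega|_[1,N] : a 2N x 2N block tridiagonal matrix *)
(* with diagonal blocks V_omega(1..N) = f(T^1 w), ..., f(T^N w) and    *)
(* off-diagonal blocks J = diag(1,0).  Row/column index k of the 2N x  *)
(* 2N matrix corresponds to site k./2 + 1 and component odd k.         *)
Definition comp (k : nat) : 'I_2 := inord (odd k).

Definition S_restr {R : realType} {Om : Type} (T : Om -> Om)
  (f : Om -> 'M[R[i]]_2) (w : Om) (N : nat) : 'M[R[i]]_(N.*2) :=
  \matrix_(k, l)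
    if k./2 == l./2 then f (iter (k./2).+1 T w) (comp k) (comp l)
    else if (k./2 == (l./2).+1) || (l./2 == (k./2).+1) then
      (if ~~ odd k && ~~ odd l then 1 else 0)
    else 0.

Definition eig_count {R : realType} {n : nat} (M : 'M[R[i]]_n) (E : R) : nat :=
  count (fun z : R[i] => (complex.Im z == 0) && (complex.Re z <= E))
    (sval (closed_field_poly_normal (char_poly M))).

Definition is_IDS {R : realType} {Om : ptopologicalType}
  (nu : probability (borel Om) R) (T : Om -> Om) (f : Om -> 'M[R[i]]_2)
  (Nids : R -> R) : Prop :=
  forall E : R, {ae nu, forall w : borel Om,
    (fun N : nat => (eig_count (S_restr T f w N) E)%:R / (N.*2)%:R) @ \oo
      --> Nids E}.

Definition schr_cocycle {R : realType} {Om : Type} (a : Om -> R) (w : Om)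
  : 'M[R]_2 := \matrix_(i, j)
    if i == 0 then (if j == 0 then a w else -1) else (if j == 0 then 1 else 0).

(* The canonical lift to R of the action of [[a,-1],[1,0]] on the      *)
(* circle of directions v = (cos th, sin th): the image vector is a     *)
(* positive multiple of (cos (schr_lift a th), sin (schr_lift a th)).   *)
(* It is continuous in (a, th), increasing in th, satisfies            *)
(* schr_lift a (th + pi) = schr_lift a th + pi, and schr_lift 0 th =    *)
(* th + pi/2 (the lift used for Schroedinger cocycles).  Explicitly,    *)
(* with k = floor((th + pi/2)/pi): schr_lift a th = k pi if             *)
(* th = k pi - pi/2, and k pi + arccot(a - tan th) otherwise, where     *)
(* arccot y = pi/2 - atan y in (0, pi).                                  *)
Definition schr_lift {R : realType} (a th : R) : R :=
  let k : R := (Num.floor ((th + pi / 2) / pi))%:~R in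
  if th == k * pi - pi / 2 then k * pi
  else k * pi + (pi / 2 - atan (a - tan th)).

Fixpoint rot_lift_iter {R : realType} {Om : Type} (T : Om -> Om)
  (a : Om -> R) (n : nat) (w : Om) (th : R) : R :=
  match n with
  | 0 => th
  | n'.+1 => schr_lift (a (iter n' T w)) (rot_lift_iter T a n' w th)
  end.

(* r is the fibered rotation number: for nu-a.e. omega and every th,   *)
(*   (lift_n(omega, th) - th) / (2 pi n) --> r,                         *)
(* normalized so that for Schroedinger cocycles IDS = 1 - 2 rho.         *)
Definition is_fibered_rotation_number {R : realType} {Om : ptopologicalType}
  (nu : probability (borel Om) R) (T : Om -> Om) (a : Om -> R) (r : R) : Prop :=
  {ae nu, forall w : borel Om, forall th : R,
    (fun n : nat => (rot_lift_iter T a n w th - th) / (2 * pi * n%:R)) @ \oo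
      --> r}.

(* the (1,1) entry of A^E(omega) *)
Definition aE {R : realType} {Om : Type} (f : Om -> 'M[R[i]]_2) (E : R)
  (w : Om) : R :=
  E - f11 f w - abs2 (f12 f w) / (E - f22 f w).

(* Main.v *)
(** Completing the square in the second component turns the quadratic form of
    [E - S_omega|[1,N]] into [sum_j (E - f22_j) |v_j - c_j u_j|^2] plus the
    form of the Jacobi matrix with diagonal [aE f E] and off-diagonal [-1].
    The pivots of the latter are [d_j = a_j - 1 / d_(j-1)], that is, the
    cotangents of the angles of the cocycle orbit, and the lifted angle passes a
    multiple of [pi] exactly when a pivot is negative.  Hence the lift after [N]
    steps is [pi] times the number of negative squares, up to a bounded error.
    Sylvester's law of inertia together with the spectral theorem identifies the
    number of nonnegative squares with [eig_count]; the [v]-part contributes [N]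
    nonnegative squares if [E > sup f22] and none if [E < inf f22].  The
    resulting estimate holds at every point with a bounded error, so that the
    rotation number converges wherever the density of states does. *)
Require Import Defs.
From HB Require Import structures.
From mathcomp Require Import all_boot all_order all_algebra.
From mathcomp Require Import all_classical all_reals all_analysis.
From mathcomp Require Import complex.
From mathcomp Require Import ring lra zify.
Import Order.TTheory GRing.Theory Num.Theory.
Import numFieldNormedType.Exports.
Local Open Scope ring_scope.
Local Open Scope classical_set_scope.

Set Implicit Arguments.
Unset Strict Implicit.

Local Open Scope sesquilinear_scope.

(** * Inertia of Hermitian forms given as weighted sums of squares *)

Definition diag_form {C : numClosedFieldType} {n : nat} (A : seq (C * 'cV[C]_n))
  (x : 'rV[C]_n) : C := \sum_(p <- A) p.1 * `|(x *m p.2) 0 0| ^+ 2.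

Definition vanish {C : numClosedFieldType} {n : nat} (A : seq (C * 'cV[C]_n))
  (x : 'rV[C]_n) : bool := all (fun p => (x *m p.2) 0 0 == 0) A.

Definition real_coefs {C : numClosedFieldType} {n : nat}
  (A : seq (C * 'cV[C]_n)) : bool := all (fun p => p.1 \is Num.real) A.

(** Zero coefficients are counted because [eig_count] includes eigenvalues equal to [E]. *)
Definition npos {C : numClosedFieldType} {n : nat} (A : seq (C * 'cV[C]_n)) :
  nat := count (fun p => 0 <= p.1) A.

(** The matrix with columns [s] has rank at most [size s < n], hence a nonzero left kernel. *)
Lemma common_zero (C : numClosedFieldType) (n : nat) (s : seq 'cV[C]_n) :
  (size s < n)%N ->
  exists2 x : 'rV[C]_n, x != 0 & forall c, c \in s -> (x *m c) 0 0 = 0.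
Proof.
move=> sn; pose B := \matrix_(i < n, j < size s) (nth 0 s j) i 0.
have kB : kermx B != 0.
  rewrite -mxrank_eq0 mxrank_ker subn_eq0 -ltnNge.
  exact: leq_ltn_trans (rank_leq_col B) sn.
have /rowV0Pn[x /sub_kermxP xB x0] := kB.
exists x => // c /(nthP 0) [j js <-].
have /rowP/(_ (Ordinal js)) := xB; rewrite !mxE => {2}<-.
by apply: eq_bigr => i _; rewrite mxE.
Qed.

(* Otherwise the linear forms with negative coefficient in [A] together with
   those with nonnegative coefficient in [B] would have a common zero
   [x != 0], at which the form is both nonnegative and negative. *)
Lemma npos_le (C : numClosedFieldType) (n : nat) (A B : seq (C * 'cV[C]_n)) :
  real_coefs A -> real_coefs B -> size A = n -> size B = n ->
  diag_form A =1 diag_form B -> (forall x, vanish B x -> x = 0) ->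
  (npos A <= npos B)%N.
Proof.
move=> /allP rA /allP rB sA sB AB injB; rewrite leqNgt; apply/negP => ltBA.
have nneg (x : C) : x \is Num.real -> ~~ (0 <= x) -> x < 0.
  by move=> xr; rewrite real_leNgt ?real0// negbK.
pose s := [seq p.2 | p <- A & ~~ (0 <= p.1)] ++ [seq p.2 | p <- B & 0 <= p.1].
have [|x x0 xs] := @common_zero C n s.
  rewrite size_cat !size_map !size_filter.
  rewrite -[X in (_ < X)%N]sA -(count_predC (fun p => 0 <= p.1) A) addnC.
  by rewrite ltn_add2r.
have pA : 0 <= diag_form A x.
  rewrite /diag_form big_seq; apply: sumr_ge0 => p pA.
  case: (boolP (0 <= p.1)) => p0.
    by rewrite mulr_ge0// exprn_ge0.
  rewrite xs ?normr0 ?expr0n ?mulr0// mem_cat; apply/orP; left.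
  by rewrite map_f// mem_filter p0.
have nB p : p \in B -> p.1 * `|(x *m p.2) 0 0| ^+ 2 <= 0.
  move=> pB; case: (boolP (0 <= p.1)) => p0.
    rewrite xs ?normr0 ?expr0n ?mulr0// mem_cat; apply/orP; right.
    by rewrite map_f// mem_filter p0.
  by rewrite mulr_le0_ge0 ?exprn_ge0// ltW// nneg// rB.
(* Every term of [B] is nonpositive at [x] and their sum is nonnegative, so each term vanishes. Then
   all linear forms of [B] vanish at [x], against [injB]. *)
have B0 : \sum_(p <- B) - (p.1 * `|(x *m p.2) 0 0| ^+ 2) == 0.
  rewrite sumrN oppr_eq0 eq_le -/(diag_form B x) -AB pA andbT AB.
  rewrite -oppr_ge0 /diag_form -sumrN.
  by rewrite big_seq; apply: sumr_ge0 => p pB; rewrite oppr_ge0 nB.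
move: B0; rewrite big_seq psumr_eq0; last by move=> p pB; rewrite oppr_ge0 nB.
move=> /allP B0; move/eqP: x0; apply; apply: injB; apply/allP => p pB.
case: (boolP (0 <= p.1)) => p0.
  rewrite xs// mem_cat; apply/orP; right.
  by rewrite map_f// mem_filter p0.
have := B0 p pB; rewrite pB /= oppr_eq0 mulf_eq0 expf_eq0 normr_eq0 /=.
by case/orP => // /eqP p10; rewrite p10 lexx in p0.
Qed.

(** * Spectral theorem and eigenvalue counting *)

Definition eigen_rep {C : numClosedFieldType} {n : nat} (M : 'M[C]_n) (c : C) :
  seq (C * 'cV[C]_n) :=
  [seq (c - spectral_diag M 0 k, col k ((spectralmx M) ^t*)) | k <- enum 'I_n].

Lemma eigen_repE (C : numClosedFieldType) (n : nat) (M : 'M[C]_n) (c : C)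
  (x : 'rV[C]_n) : M \is hermsymmx ->
  diag_form (eigen_rep M c) x = (x *m (c%:M - M) *m x ^t*) 0 0.
Proof.
move=> /hermitian_normalmx/orthomx_spectralP Me.
set P := spectralmx M in Me *; set sp := spectral_diag M in Me *.
have PU : P \is unitarymx by exact: spectral_unitarymx.
have -> : c%:M - M = P ^t* *m diag_mx (const_mx c - sp) *m P.
  rewrite [M in LHS]Me invmx_unitary// linearB /= mulmxBr mulmxBl.
  congr (_ - _); rewrite diag_const_mx mul_mx_scalar -scalemxAl.
  by rewrite -invmx_unitary// mulVmx ?unitarymx_unit// scalemx1.
rewrite !mulmxA -mulmxA.
have -> : P *m x ^t* = (x *m P ^t*) ^t*.
  by rewrite trmx_mul map_mxM trmxCK.
rewrite mul_mx_diag mxE /diag_form /eigen_rep big_map big_enum /=.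
apply: eq_bigr => k _; rewrite -/P -/sp normCK.
have -> : (x *m col k (P ^t*)) 0 0 = (x *m P ^t*) 0 k.
  by rewrite !mxE; apply: eq_bigr => i _; rewrite !mxE.
set y := x *m P ^t*; clearbody y; rewrite !mxE; ring.
Qed.

Lemma eigen_rep_inj (C : numClosedFieldType) (n : nat) (M : 'M[C]_n) (c : C)
  (x : 'rV[C]_n) : vanish (eigen_rep M c) x -> x = 0.
Proof.
move=> /allP v; have PU : spectralmx M \is unitarymx by exact: spectral_unitarymx.
suff e : x *m (spectralmx M) ^t* = 0.
  rewrite -[x]mulmx1 -(mulVmx (unitarymx_unit PU)) invmx_unitary//.
  by rewrite mulmxA e mul0mx.
apply/rowP => k; rewrite [RHS]mxE.
have /v/eqP/= <- : (c - spectral_diag M 0 k, col k ((spectralmx M) ^t*))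
    \in eigen_rep M c by apply: (map_f (fun k => (_, col k _))); rewrite mem_enum.
by rewrite !mxE; apply: eq_bigr => i _; rewrite !mxE.
Qed.

(** This links the roots of the characteristic polynomial, which [eig_count] counts, with the
    diagonal used in [eigen_rep]. *)
Lemma char_poly_spectral (C : numClosedFieldType) (n : nat) (M : 'M[C]_n) :
  M \is normalmx ->
  char_poly M = \prod_(k < n) ('X - (spectral_diag M 0 k)%:P).
Proof.
move=> /orthomx_spectralP Me.
set P := spectralmx M in Me *; set sp := spectral_diag M in Me *.
have Pu : P \in unitmx by exact: spectral_unit.
transitivity (char_poly (diag_mx sp)); last first.
  rewrite char_poly_trig ?diag_mx_is_trig//.
  by apply: eq_bigr => k _; rewrite mxE eqxx mulr1n.
rewrite /char_poly.
have -> : char_poly_mx M =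
    map_mx polyC (invmx P) *m char_poly_mx (diag_mx sp) *m map_mx polyC P.
  rewrite /char_poly_mx [M in LHS]Me !map_mxM /= mulmxBr mulmxBl.
  congr (_ - _); rewrite mul_mx_scalar -scalemxAl -map_mxM mulVmx//.
  by rewrite map_mx1 scalemx1.
rewrite !det_mulmx mulrC mulrA -det_mulmx -map_mxM mulmxV// map_mx1 det1.
by rewrite mul1r.
Qed.

(** Sylvester's law: [npos_le] in both directions between [A] and the eigenbasis representation,
    whose coefficients are [E] minus the eigenvalues. *)
Lemma eig_countE (R : realType) (n : nat) (M : 'M[R[i]]_n) (E : R)
  (A : seq (R[i] * 'cV[R[i]]_n)) :
  M \is hermsymmx -> real_coefs A -> size A = n ->
  (forall x, diag_form A x = (x *m ((real_complex R E)%:M - M) *m x ^t*) 0 0) ->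
  (forall x, vanish A x -> x = 0) ->
  eig_count M E = npos A.
Proof.
move=> Mh rA sA AM iA; set c := real_complex R E in AM *.
have rB : real_coefs (eigen_rep M c).
  apply/allP => _ /mapP[k _ ->] /=; rewrite realB ?complex_real ?eqxx//.
  by have /mxOverP := hermitian_spectral_diag_real Mh; exact.
have sB : size (eigen_rep M c) = n by rewrite size_map size_enum_ord.
have AB : diag_form A =1 diag_form (eigen_rep M c).
  by move=> x; rewrite AM eigen_repE.
have -> : npos A = npos (eigen_rep M c).
  apply/eqP; rewrite eqn_leq (npos_le rA rB sA sB AB (@eigen_rep_inj _ _ M c)).
  by rewrite (npos_le rB rA sB sA (fsym AB) iA).
rewrite /eig_count; case: closed_field_poly_normal => s /= se.
move: se; rewrite (monicP (char_poly_monic M)) scale1r.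
rewrite char_poly_spectral ?hermitian_normalmx// -big_enum /=.
rewrite -(big_map (spectral_diag M 0) xpredT (fun z => 'X - z%:P)).
move=> /prod_XsubC_eq/permP.
move=> /(_ (fun z => (complex.Im z == 0) && (complex.Re z <= E))) <-.
rewrite /npos /eigen_rep !count_map; apply: eq_count => k /=.
(* The order on [R[i]] compares only numbers with equal imaginary parts, so nonnegativity of [c - z]
   is exactly the test made by [eig_count]. *)
by rewrite subr_ge0 lecE /= eq_sym.
Qed.

(** * The lifted action in the cotangent coordinate *)

Lemma tan_shift (R : realType) (x : R) (k : int) :
  tan (x + k%:~R * pi) = tan x.
Proof.
have n_shift (n : nat) (y : R) : tan (y + n%:R * pi) = tan y.
  elim: n y => [|n IHn] y; first by rewrite mul0r addr0.
  by rewrite -natr1 mulrDl mul1r addrA tanDpi IHn.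
case: k => n; first exact: n_shift.
by rewrite NegzE mulrNz mulNr -[in RHS](subrK (n.+1%:R * pi) x) n_shift.
Qed.

(** At [d = 0] both sides are 0, by the convention for division by 0. *)
Lemma tan_arccot (R : realType) (d : R) : tan (pi / 2 - atan d) = d^-1.
Proof.
rewrite -[in RHS](atanK d) /tan sinB cosB sin_pihalf cos_pihalf.
by rewrite !mul0r !mul1r subr0 add0r invf_div.
Qed.

Lemma intr1_mul (R : realType) (x : R) (k : int) :
  (k + 1)%:~R * x = k%:~R * x + x.
Proof. by rewrite intrD mulrDl mul1r. Qed.

(** At a multiple of [pi] the cotangent is infinite, and [a - 1/d] degenerates to [a]. *)
Lemma lift_pole (R : realType) (a : R) (k : int) :
  schr_lift a (k%:~R * pi) = k%:~R * pi + (pi / 2 - atan a).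
Proof.
have p0 := pi_gt0 R; rewrite /schr_lift.
have -> : Num.floor ((k%:~R * pi + pi / 2) / pi : R) = k.
  apply: floor_def; rewrite ler_pdivlMr// ltr_pdivrMr// intr1_mul.
  by apply/andP; split; lra.
rewrite ifF; last by apply/eqP; lra.
by rewrite -[in tan _](add0r (k%:~R * pi)) tan_shift tan0 subr0.
Qed.

(** The cotangent [d] is sent to [a - 1/d], and the index [k] grows exactly when the old pivot is
    negative. A zero pivot lands on the next multiple of [pi]. *)
Lemma lift_arccot (R : realType) (a d : R) (k : int) :
  schr_lift a (k%:~R * pi + (pi / 2 - atan d)) =
  if d == 0 then (k + 1)%:~R * pi
  else (if d < 0 then k + 1 else k)%:~R * pi + (pi / 2 - atan (a - d^-1)).
Proof.
have p0 := pi_gt0 R; have d1 := atan_gtNpi2 d; have d2 := atan_ltpi2 d.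
have d3 : 0 < d -> 0 < atan d by rewrite -{2}atan0; exact: lt_atan.
have d4 : d < 0 -> atan d < 0 by rewrite -{2}atan0; exact: lt_atan.
rewrite /schr_lift.
(* The branches of [schr_lift] change at vertical directions, halfway between multiples of [pi]; the
   angle is past that point when [d <= 0]. *)
have -> : Num.floor ((k%:~R * pi + (pi / 2 - atan d) + pi / 2) / pi : R) =
    if d <= 0 then k + 1 else k.
  apply: floor_def; rewrite ler_pdivlMr// ltr_pdivrMr// !intr1_mul.
  by case: (ltrgtP d 0) => [/d4 ?|/d3 ?|->]; rewrite ?atan0 ?intr1_mul;
    apply/andP; split; lra.
case: (ltrgtP d 0) => [/d4 d0|/d3 d0|->]; last first.
- by rewrite ifT// atan0 intr1_mul; apply/eqP; lra.
- rewrite ifF; last by apply/eqP; lra.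
  by rewrite [X in tan X]addrC tan_shift tan_arccot.
- rewrite ifF; last by rewrite intr1_mul; apply/eqP; lra.
  by rewrite [X in tan X]addrC tan_shift tan_arccot.
Qed.

(** * Gaussian elimination for Jacobi forms *)

Definition jacobi_form {R : realType} (a : nat -> R) (u : nat -> R[i])
  (N : nat) : R[i] :=
  \sum_(j < N) real_complex R (a j) * `|u j| ^+ 2 -
  \sum_(j < N.-1) (u j * (u j.+1)^* + u j.+1 * (u j)^*).

Lemma jacobi_formSS (R : realType) (a : nat -> R) (u : nat -> R[i]) (N : nat) :
  jacobi_form a u N.+2 = jacobi_form a u N.+1 +
    real_complex R (a N.+1) * `|u N.+1| ^+ 2 -
    (u N * (u N.+1)^* + u N.+1 * (u N)^*).
Proof.
by rewrite /jacobi_form /= big_ord_recr [in X in _ - X]big_ord_recr /=; ring.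
Qed.

Lemma conj_real_complex (R : realType) (r : R) :
  (real_complex R r)^* = real_complex R r.
Proof. by apply/CrealP; rewrite complex_real eqxx. Qed.

Lemma real_complex_ge0 (R : realType) (r : R) : (0 <= real_complex R r) = (0 <= r).
Proof. by rewrite lecE /= eqxx. Qed.

Lemma complete_square (R : realType) (a d : R) (p q : R[i]) : d != 0 ->
  real_complex R d * `|p| ^+ 2 + real_complex R a * `|q| ^+ 2 -
    (p * q^* + q * p^*) =
  real_complex R d * `|p - real_complex R d^-1 * q| ^+ 2 +
  real_complex R (a - d^-1) * `|q| ^+ 2.
Proof.
move=> d0; rewrite !normCK !rmorphB !rmorphM /= !conj_real_complex.
rewrite !fmorphV; field.
by rewrite fmorph_eq0.
Qed.

(** With [z = (a / 2) y - w], this is polarization of [y z^* + z y^*]. It replaces [complete_square]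
    after a zero pivot and yields one square of each sign. *)
Lemma hyperbolic_squares (R : realType) (a : R) (y w : R[i]) :
  real_complex R a * `|y| ^+ 2 - (w * y^* + y * w^*) =
  real_complex R (2^-1) * `|y + (real_complex R (a / 2) * y - w)| ^+ 2 +
  real_complex R (- 2^-1) * `|y - (real_complex R (a / 2) * y - w)| ^+ 2.
Proof.
rewrite !normCK !(rmorphD, rmorphB, rmorphN, rmorphM) /= !conj_real_complex.
rewrite !fmorphV !rmorph_nat; by field.
Qed.

Lemma npos_cons (R : realType) (n : nat) (r : R) (v : 'cV[R[i]]_n)
  (A : seq (R[i] * 'cV[R[i]]_n)) :
  npos ((real_complex R r, v) :: A) = ((0 <= r)%R + npos A)%N.
Proof. by rewrite /npos /= real_complex_ge0. Qed.

Lemma real_coefs_cons (R : realType) (n : nat) (r : R) (v : 'cV[R[i]]_n)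
  (A : seq (R[i] * 'cV[R[i]]_n)) :
  real_coefs ((real_complex R r, v) :: A) = real_coefs A.
Proof. by rewrite /real_coefs /= complex_real eqxx. Qed.

Lemma diag_form_cons (C : numClosedFieldType) (n : nat) (c : C) (v : 'cV[C]_n)
  (A : seq (C * 'cV[C]_n)) (x : 'rV[C]_n) :
  diag_form ((c, v) :: A) x = c * `|(x *m v) 0 0| ^+ 2 + diag_form A x.
Proof. by rewrite /diag_form big_cons. Qed.

Lemma vanish_cons (C : numClosedFieldType) (n : nat) (c : C) (v : 'cV[C]_n)
  (A : seq (C * 'cV[C]_n)) (x : 'rV[C]_n) :
  vanish ((c, v) :: A) x = ((x *m v) 0 0 == 0) && vanish A x.
Proof. by []. Qed.

Lemma pairingD (R : pzRingType) (n : nat) (x : 'rV[R]_n) (p q : 'cV[R]_n) :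
  (x *m (p + q)) 0 0 = (x *m p) 0 0 + (x *m q) 0 0.
Proof. by rewrite mulmxDr mxE. Qed.

Lemma pairingN (R : pzRingType) (n : nat) (x : 'rV[R]_n) (p : 'cV[R]_n) :
  (x *m (- p)) 0 0 = - (x *m p) 0 0.
Proof. by rewrite mulmxN mxE. Qed.

Lemma pairingZ (R : comPzRingType) (n : nat) (x : 'rV[R]_n) (c : R)
  (p : 'cV[R]_n) : (x *m (c *: p)) 0 0 = c * (x *m p) 0 0.
Proof. by rewrite -scalemxAr mxE. Qed.

(* The invariant of the Gaussian elimination: either the next pivot is the
   finite number [d], the cotangent of the lifted angle, or the previous pivot
   vanished and the angle is a multiple of [pi]; then the last variable is
   coupled to a single linear form [W]. *)
Lemma jacobi_elimination (R : realType) (Om : Type) (T : Om -> Om)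
  (a : Om -> R) (w : Om) (n : nat) (U : nat -> 'cV[R[i]]_n) (N : nat) :
  let b := fun j => a (iter j T w) in
  let u := fun (x : 'rV[R[i]]_n) j => (x *m U j) 0 0 in
  let th := rot_lift_iter T a N.+1 w 0 in
  (exists (k : nat) (d : R) (A : seq (R[i] * 'cV[R[i]]_n)),
    [/\ th = k%:R * pi + (pi / 2 - atan d), size A = N /\ real_coefs A,
      (npos A + k)%N = N,
      forall x, jacobi_form b (u x) N.+1 =
        diag_form A x + real_complex R d * `|u x N| ^+ 2 &
      forall x, vanish A x -> u x N = 0 ->
        forall j, (j <= N)%N -> u x j = 0]) \/
  (exists (k : nat) (W : 'cV[R[i]]_n) (A : seq (R[i] * 'cV[R[i]]_n)),
    [/\ th = k.+1%:R * pi, (size A).+1 = N /\ real_coefs A,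
      (npos A + k)%N = size A,
      forall x, jacobi_form b (u x) N.+1 = diag_form A x +
        (real_complex R (b N) * `|u x N| ^+ 2 -
         ((x *m W) 0 0 * (u x N)^* + u x N * ((x *m W) 0 0)^*)) &
      forall x, vanish A x -> (x *m W) 0 0 = 0 -> u x N = 0 ->
        forall j, (j <= N)%N -> u x j = 0]).
Proof.
move=> b u; elim: N => [|N].
  (* The initial angle 0 is a pole of the cotangent, so the first pivot is [b 0]. *)
  left; exists 0%N, (b 0%N), [::]; split => //.
  - rewrite /= mul0r add0r. have := lift_pole (b 0%N) 0; rewrite mul0r add0r; exact.
  - move=> x; rewrite /jacobi_form /= big_ord_recl !big_ord0 /diag_form big_nil.
    by rewrite addr0 add0r subr0.
  - by move=> x _ u0 [].
rewrite /= -/(rot_lift_iter T a N.+1 w 0) -[a (T (iter N T w))]/(b N.+1).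
case=> [[k [d [A [-> [sA rA] kA fA iA]]]]|[k [W [A [-> [sA rA] kA fA iA]]]]].
- have -> : k%:R = (k%:Z)%:~R :> R by [].
  rewrite lift_arccot; case: eqVneq => [d0|d0].
    (* With a zero pivot the square of [u x N] disappears, and this variable survives only through
       its coupling to the next one. *)
    right; exists k, (U N), A; split.
    + by rewrite -natr1 intrD.
    + by rewrite sA.
    + by rewrite sA.
    + by move=> x; rewrite jacobi_formSS fA d0; rewrite rmorph0 mul0r addr0 addrA.
    + move=> x vA uN uN1 j; rewrite leq_eqVlt => /orP[/eqP->//|].
      exact: iA.
  (* A nonzero pivot is split off as a square; [k] counts the negative ones. *)
  left; exists ((d < 0)%R + k)%N, (b N.+1 - d^-1),
    ((real_complex R d, U N - real_complex R d^-1 *: U N.+1) :: A); split.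
  + by case: (d < 0); rewrite /= ?addn0 ?add0n ?add1n -?natr1 ?intrD.
  + by rewrite real_coefs_cons /= sA.
  + by rewrite npos_cons leNgt; case: (d < 0) => /=; lia.
  + move=> x; rewrite jacobi_formSS fA diag_form_cons.
    have := complete_square (b N.+1) (u x N) (u x N.+1) d0.
    rewrite !(pairingD, pairingN, pairingZ) -!/(u x _) => cs.
    rewrite [RHS]addrAC -cs; ring.
  + move=> x; rewrite vanish_cons !(pairingD, pairingN, pairingZ).
    move=> /andP[/eqP uN vA] u1.
    rewrite -/(u x N.+1) -/(u x N) u1 mulr0 subr0 in uN.
    by move=> j; rewrite leq_eqVlt => /orP[/eqP->//|]; exact: iA.
- have -> : k.+1%:R = (k.+1%:Z)%:~R :> R by [].
  rewrite lift_pole; pose y := U N.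
  (* Variable [N] is coupled to [W] on one side and to its new neighbour on the other. The resulting
     hyperbolic pair adds one negative square, already accounted for by the angle [k.+1 * pi]. *)
  pose z := real_complex R (b N / 2) *: U N - (W + U N.+1).
  left; exists k.+1, (b N.+1),
   ((real_complex R 2^-1, y + z) :: (real_complex R (- 2^-1), y - z) :: A); split.
  + by [].
  + by rewrite !real_coefs_cons /= sA.
  + rewrite !npos_cons invr_ge0 ler0n oppr_ge0 leNgt invr_gt0 ltr0n /=.
    by rewrite -sA -kA; lia.
  + move=> x; rewrite jacobi_formSS fA !diag_form_cons.
    rewrite !(pairingD, pairingN, pairingZ) -!/(u x _).
    have := hyperbolic_squares (b N) (u x N) ((x *m W) 0 0 + u x N.+1).
    rewrite !addrA => <-; rewrite !rmorphD /=; ring.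
  + move=> x; rewrite !vanish_cons !(pairingD, pairingN, pairingZ) -!/(u x _).
    move=> /and3P[/eqP p /eqP m vA] u1.
    have uN : u x N = 0.
      apply: (mulfI (x := 2)); first by rewrite pnatr_eq0.
      by rewrite mulr0 -[RHS](addr0 0) -{1}p -m; ring.
    have W0 : (x *m W) 0 0 = 0 by rewrite -m uN u1; ring.
    by move=> j; rewrite leq_eqVlt => /orP[/eqP->//|]; exact: iA.
Qed.

(** The last pivot, or the last hyperbolic pair, completes the list of squares. The sign of the last
    pivot is not yet visible in the angle, which the error [pi] absorbs. *)
Lemma jacobi_inertia (R : realType) (Om : Type) (T : Om -> Om)
  (a : Om -> R) (w : Om) (n : nat) (U : nat -> 'cV[R[i]]_n) (N : nat) :
  let u := fun (x : 'rV[R[i]]_n) j => (x *m U j) 0 0 in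
  exists A : seq (R[i] * 'cV[R[i]]_n),
    [/\ size A = N, real_coefs A,
      forall x, jacobi_form (fun j => a (iter j T w)) (u x) N = diag_form A x,
      forall x, vanish A x -> forall j, (j < N)%N -> u x j = 0 &
      `|rot_lift_iter T a N w 0 - (N%:R - (npos A)%:R) * pi| <= pi].
Proof.
have p0 := pi_gt0 R; case: N => [|N] u.
  exists [::]; split => //.
  - by move=> x; rewrite /jacobi_form /diag_form !big_ord0 big_nil subr0.
  - by rewrite /npos /= subr0 mul0r subr0 normr0 ltW.
have [[k [d [A [-> [sA rA] kA fA iA]]]]|[k [W [A [-> [sA rA] kA fA iA]]]]] :=
  jacobi_elimination T a w U N.
- have d1 := atan_gtNpi2 d; have d2 := atan_ltpi2 d.
  have d3 : 0 <= d -> 0 <= atan d by rewrite -{2}atan0; exact: le_atan.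
  have d4 : d < 0 -> atan d < 0 by rewrite -{2}atan0; exact: lt_atan.
  exists ((real_complex R d, U N) :: A); split.
  + by rewrite /= sA.
  + by rewrite real_coefs_cons.
  + by move=> x; rewrite fA diag_form_cons addrC.
  + move=> x; rewrite vanish_cons => /andP[/eqP uN vA] j.
    by rewrite ltnS; exact: iA.
  + rewrite npos_cons -[N.+1]addn1 -kA !natrD.
    have -> (m l s t : R) : m + l + s - (t + m) = l + s - t by ring.
    by case: (lerP 0 d) => [/d3|/d4] d0; rewrite ler_norml /=;
      apply/andP; split; lra.
- pose y := U N; pose z := real_complex R (a (iter N T w) / 2) *: U N - W.
  exists ((real_complex R 2^-1, y + z) :: (real_complex R (- 2^-1), y - z) :: A).
  split.
  + by rewrite /= sA.
  + by rewrite !real_coefs_cons.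
  + move=> x; rewrite fA !diag_form_cons.
    rewrite hyperbolic_squares !(pairingD, pairingN, pairingZ).
    by rewrite [LHS]addrC -addrA.
  + move=> x; rewrite !vanish_cons !(pairingD, pairingN, pairingZ) -!/(u x _).
    move=> /and3P[/eqP p /eqP m vA].
    have uN : u x N = 0.
      apply: (mulfI (x := 2)); first by rewrite pnatr_eq0.
      by rewrite mulr0 -[RHS](addr0 0) -{1}p -m; ring.
    have W0 : (x *m W) 0 0 = 0 by rewrite -m uN; ring.
    by move=> j; rewrite ltnS; exact: iA.
  + rewrite !npos_cons invr_ge0 ler0n.
    have -> : (0 <= - (2^-1 : R)) = false by apply/negbTE; rewrite -ltNge; lra.
    rewrite /= add0n add1n -sA -kA -[(npos A + k).+2]addn2 -[k.+1]addn1
      -[(npos A).+1]addn1 !natrD.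
    have -> (m l t : R) : m + l + 2 - (m + t) = l + 2 - t by ring.
    by rewrite ler_norml; apply/andP; split; lra.
Qed.

(** * Monotonicity of the lift and dependence on the initial angle *)

Lemma ex_floor_pi (R : realType) (th : R) : exists k : int,
  k%:~R * pi <= th < k%:~R * pi + pi.
Proof.
have p0 := pi_gt0 R; exists (Num.floor (th / pi)).
rewrite -intr1_mul -ler_pdivlMr// -ltr_pdivrMr//.
by rewrite floor_le_tmp floorD1_gt.
Qed.

Lemma arccot_param (R : realType) (th : R) (k : int) :
  k%:~R * pi <= th < k%:~R * pi + pi ->
  th = k%:~R * pi \/ exists d, th = k%:~R * pi + (pi / 2 - atan d).
Proof.
have p0 := pi_gt0 R; move=> /andP[k1 k2].
have [->|nk] := eqVneq th (k%:~R * pi); first by left.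
have k3 : k%:~R * pi < th by rewrite lt_neqAle eq_sym nk.
right; exists (tan (pi / 2 - (th - k%:~R * pi))).
rewrite tanK ?in_itv/=; first by lra.
by apply/andP; split; lra.
Qed.

(** The bounds are the images of the two endpoints, as computed by [lift_pole]. *)
Lemma lift_bounds (R : realType) (a th : R) (k : int) :
  k%:~R * pi <= th < k%:~R * pi + pi ->
  k%:~R * pi + (pi / 2 - atan a) <= schr_lift a th
    <= k%:~R * pi + pi + (pi / 2 - atan a).
Proof.
have p0 := pi_gt0 R; have a1 := atan_gtNpi2 a; have a2 := atan_ltpi2 a.
move=> /arccot_param[->|[d ->]].
  by rewrite lift_pole; apply/andP; split; lra.
have b1 := atan_gtNpi2 (a - d^-1); have b2 := atan_ltpi2 (a - d^-1).
rewrite lift_arccot; case: (ltrgtP d 0) => d0.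
- have : atan a <= atan (a - d^-1).
    by apply: le_atan; rewrite lerDl oppr_ge0 invr_le0 ltW.
  by rewrite intr1_mul => ?; apply/andP; split; lra.
- have : atan (a - d^-1) <= atan a.
    by apply: le_atan; rewrite gerDl oppr_le0 invr_ge0 ltW.
  by move=> ?; apply/andP; split; lra.
- by rewrite intr1_mul; apply/andP; split; lra.
Qed.

(** Angles in different intervals are separated by [lift_bounds]. Within one interval the cotangent
    decreases in the angle, and [a - 1/d] increases in [d] on each half-line; across the sign change
    the index decides. *)
Lemma lift_mono (R : realType) (a : R) : {homo schr_lift a : s t / s <= t}.
Proof.
have p0 := pi_gt0 R; move=> s t st.
have [k ks] := ex_floor_pi s; have [l lt] := ex_floor_pi t.
have /andP[s1 s2] := lift_bounds a ks; have /andP[t1 t2] := lift_bounds a lt.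
have [kl|lk] := ltP k l.
  apply: (le_trans s2); apply: le_trans t1.
  rewrite lerD2r -intr1_mul ler_wpM2r ?ler_int; [by []|exact: ltW|].
  by rewrite lezD1.
have kl : k <= l.
  rewrite -ltzD1 -(ltr_int R) -(ltr_pM2r p0) intr1_mul.
  by move: ks lt => /andP[ks1 ks2] /andP[lt1 lt2]; lra.
have {kl lk}e : k = l by apply/eqP; rewrite eq_le kl lk.
rewrite -e in lt t1 t2.
have [se|[c se]] := arccot_param ks; have [te|[d te]] := arccot_param lt.
- by rewrite se te.
- by rewrite [in leLHS]se lift_pole.
- by have := atan_ltpi2 c; lra.
have dc : d <= c.
  by rewrite leNgt; apply/negP => /lt_atan; lra.
have c1 := atan_gtNpi2 (a - c^-1); have d1 := atan_ltpi2 (a - d^-1).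
rewrite se te !lift_arccot.
have inv_le (x y : R) : x <= y -> 0 < x * y ->
    atan (a - x^-1) <= atan (a - y^-1).
  move=> xy xy0; apply: le_atan; rewrite lerD2l lerN2.
  have [x0 y0] : x != 0 /\ y != 0.
    by split; apply: contraTneq xy0 => ->; rewrite ?mul0r ?mulr0 ltxx.
  have -> : x^-1 = y^-1 + (y - x) / (x * y) by field; rewrite x0 y0.
  by rewrite lerDl divr_ge0 ?subr_ge0// ltW.
case: (ltrgtP c 0) => c0; case: (ltrgtP d 0) => d0; rewrite ?intr1_mul; try lra.
- by have := inv_le _ _ dc; rewrite nmulr_rgt0 ?c0// => /(_ isT); lra.
- by have := inv_le _ _ dc (mulr_gt0 d0 c0); lra.
Qed.

Lemma lift_addpi (R : realType) (a th : R) :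
  schr_lift a (th + pi) = schr_lift a th + pi.
Proof.
have [k /arccot_param[->|[d ->]]] := ex_floor_pi th.
  by rewrite -intr1_mul !lift_pole intr1_mul addrAC.
rewrite addrAC -intr1_mul !lift_arccot; case: eqP => _; first by rewrite -intr1_mul.
by case: ifP => _; rewrite !intr1_mul addrAC.
Qed.

Lemma lift_displacement (R : realType) (a th : R) :
  `|schr_lift a th - th| <= 2 * pi.
Proof.
have p0 := pi_gt0 R.
have [k kth] := ex_floor_pi th; have /andP[b1 b2] := lift_bounds a kth.
have a1 := atan_gtNpi2 a; have a2 := atan_ltpi2 a; move: kth => /andP[k1 k2].
by rewrite ler_norml; apply/andP; split; lra.
Qed.

(** A monotone map commuting with translation by [pi] preserves such inequalities, so the initial
    angle affects all iterates by a bounded amount. *)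
Lemma rot_lift_iter_quasi_mono (R : realType) (Om : Type) (T : Om -> Om)
  (a : Om -> R) (n m : nat) (w : Om) (s t : R) : s <= t + m%:R * pi ->
  rot_lift_iter T a n w s <= rot_lift_iter T a n w t + m%:R * pi.
Proof.
have lift_add b r : schr_lift b (r + m%:R * pi) = schr_lift b r + m%:R * pi.
  elim: m => [|m IHm]; first by rewrite mul0r !addr0.
  by rewrite -natr1 (mulrDl m%:R) mul1r (addrA r) lift_addpi IHm -addrA.
move=> st; elim: n => [//|n IHn] /=.
by rewrite -lift_add; apply: lift_mono.
Qed.

Lemma rot_lift_iterSr (R : realType) (Om : Type) (T : Om -> Om)
  (a : Om -> R) (n : nat) (w : Om) (th : R) :
  rot_lift_iter T a n.+1 w th = rot_lift_iter T a n (T w) (schr_lift (a w) th).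
Proof.
elim: n => [//|n IHn]; rewrite [LHS]/= -/(rot_lift_iter T a n.+1 w th) IHn.
by rewrite -iterS iterSr.
Qed.

(** The cocycle starts at site 0 but [S_restr] at site 1, hence [iter j.+1]. The bound [B] is chosen
    before [N], so it is uniform in the number of steps. *)
Lemma rot_lift_iter_npos (R : realType) (Om : Type) (T : Om -> Om)
  (a : Om -> R) (w : Om) (th : R) : exists B : R,
  forall (n : nat) (U : nat -> 'cV[R[i]]_n) (N : nat),
  let u := fun (x : 'rV[R[i]]_n) j => (x *m U j) 0 0 in
  exists A : seq (R[i] * 'cV[R[i]]_n),
    [/\ size A = N, real_coefs A,
      forall x, jacobi_form (fun j => a (iter j.+1 T w)) (u x) N = diag_form A x,
      forall x, vanish A x -> forall j, (j < N)%N -> u x j = 0 &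
      `|rot_lift_iter T a N w th - th - (N%:R - (npos A)%:R) * pi| <= B].
Proof.
have p0 := pi_gt0 R; set s := schr_lift (a w) th.
pose m := Num.bound (`|s| / pi).
have /andP[s1 s2] : - (m%:R * pi) <= s <= m%:R * pi.
  rewrite -ler_norml -ler_pdivrMr// ltW//.
  by apply: archi_boundP; rewrite divr_ge0// ltW.
(* The terms account for subtracting [th], replacing the start [s] by 0, one extra step ([2 * pi]),
   and the error in [jacobi_inertia] ([pi]). *)
exists (`|th| + m%:R * pi + 3 * pi) => n U N u.
have [A [sA rA fA iA tA]] := jacobi_inertia T a (T w) U N.
exists A; split => //.
  move=> x; rewrite -fA /jacobi_form; congr (_ - _).
  by apply: eq_bigr => j _; rewrite iterSr.
have e := rot_lift_iterSr T a N w th.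
have d := lift_displacement (a (iter N T w)) (rot_lift_iter T a N w th).
rewrite -/(rot_lift_iter T a N.+1 w th) e -/s in d.
have l1 : rot_lift_iter T a N (T w) s <= rot_lift_iter T a N (T w) 0 + m%:R * pi.
  by apply: rot_lift_iter_quasi_mono; rewrite add0r.
have l2 : rot_lift_iter T a N (T w) 0 <= rot_lift_iter T a N (T w) s + m%:R * pi.
  by apply: rot_lift_iter_quasi_mono; lra.
have h1 := ler_norm th; have h2 := lerNnormlW (lexx `|th|).
move: tA d; rewrite !ler_norml => /andP[t1 t2] /andP[d1 d2].
by apply/andP; split; lra.
Qed.

(** * The quadratic form of the restricted operator *)

Lemma big_ord_double (V : nmodType) (F : nat -> V) (N : nat) :
  \sum_(k < N.*2) F k = \sum_(j < N) (F j.*2 + F j.*2.+1).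
Proof.
elim: N => [|N IHN]; first by rewrite !big_ord0.
by rewrite doubleS !big_ord_recr /= IHN addrA.
Qed.

Lemma big_tridiagonal (V : nmodType) (D : nat -> V) (B : nat -> nat -> V)
  (N : nat) :
  \sum_(i < N) \sum_(j < N)
    (if i == j :> nat then D i
     else if ((i : nat) == j.+1) || ((j : nat) == i.+1) then B i j else 0) =
  \sum_(i < N) D i + \sum_(i < N.-1) (B i i.+1 + B i.+1 i).
Proof.
elim: N => [|[|N] IHN]; first by rewrite !big_ord0 addr0.
  by rewrite !big_ord_recr !big_ord0 /= !add0r addr0.
rewrite big_ord_recr /= (eq_bigr _ (fun i _ => big_ord_recr _ _)) big_split /=.
rewrite IHN.
have -> : \sum_(i < N.+1) (if i == N.+1 :> nat then D i
   else if ((i : nat) == N.+2) || (N.+1 == i.+1) then B i N.+1 else 0) = B N N.+1.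
  rewrite big_ord_recr /= big1 ?add0r; last first.
    move=> i _; have := ltn_ord i => iN.
    by rewrite !ifF//; apply/negbTE; lia.
  by rewrite ifF ?ifT ?eqxx ?orbT//; apply/negbTE; lia.
have -> : \sum_(j < N.+2) (if N.+1 == j :> nat then D N.+1
   else if (N.+1 == j.+1) || ((j : nat) == N.+2) then B N.+1 j else 0) =
   B N.+1 N + D N.+1.
  rewrite !big_ord_recr /= big1 ?add0r; last first.
    move=> i _; have := ltn_ord i => iN.
    by rewrite !ifF//; apply/negbTE; lia.
  rewrite eqxx; congr (_ + _).
  by rewrite ifF ?ifT ?eqxx ?orbT//; apply/negbTE; lia.
rewrite [in RHS]big_ord_recr [X in _ = _ + X]big_ord_recr /=.
by rewrite [RHS]addrACA -[LHS]addrA; congr (_ + _); rewrite addrA addrC.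
Qed.

Lemma compE (j : nat) : Defs.comp j.*2 = 0 /\ Defs.comp j.*2.+1 = 1.
Proof.
by split; apply/val_inj; rewrite /Defs.comp /= odd_double inordK.
Qed.

Lemma S_restr_hermitian (R : realType) (Om : Type) (T : Om -> Om)
  (f : Om -> 'M[R[i]]_2) (w : Om) (N : nat) :
  (forall w i j, f w j i = (f w i j)^*) -> S_restr T f w N \is hermsymmx.
Proof.
move=> fsa; apply/is_hermitianmxP; rewrite expr0 scale1r; apply/matrixP => k l.
rewrite !mxE [(l./2 == k./2)]eq_sym; case: eqP => [->|_]; first exact: fsa.
rewrite orbC; case: ifP => _; last by rewrite rmorph0.
by rewrite andbC; case: ifP => _; rewrite ?rmorph1 ?rmorph0.
Qed.

Lemma abs2E (R : realType) (z : R[i]) : real_complex R (abs2 z) = z * z^*.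
Proof.
by rewrite -normCK normc_def -rmorphXn /= sqr_sqrtr// addr_ge0// sqr_ge0.
Qed.

Lemma schur_complement (R : realType) (Om : Type) (f : Om -> 'M[R[i]]_2)
  (E : R) (w : Om) (u v : R[i]) :
  (forall w i j, f w j i = (f w i j)^*) -> E - f22 f w != 0 ->
  real_complex R E * (u * u^* + v * v^*) -
    (u * f w 0 0 * u^* + u * f w 0 1 * v^* +
     (v * f w 1 0 * u^* + v * f w 1 1 * v^*)) =
  real_complex R (E - f22 f w) *
    `|v - f w 0 1 / real_complex R (E - f22 f w) * u| ^+ 2 +
  real_complex R (aE f E w) * `|u| ^+ 2.
Proof.
move=> fsa e0.
have fR i : f w i i = real_complex R (complex.Re (f w i i)).
  by have /complex_realP[r ->] : f w i i \is Num.real by apply/CrealP; rewrite -fsa.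
rewrite (fR 0) (fR 1) -/(f11 f w) -/(f22 f w) (fsa w 0 1).
rewrite /aE !(rmorphB (real_complex R)) rmorphM fmorphV /= abs2E /f12 !normCK.
rewrite rmorphB !rmorphM fmorphV !(rmorphB (real_complex R)) /= !rmorphB.
rewrite /= !conj_real_complex; field.
by rewrite -rmorphB fmorph_eq0.
Qed.

Lemma pairing_site (R : pzRingType) (n : nat) (x : 'rV[R]_n) (k : 'I_n) :
  (x *m (\col_(i < n) ((i : nat) == k)%:R)) 0 0 = x 0 k.
Proof.
rewrite mxE (bigD1 k)//= mxE eqxx mulr1 big1 ?addr0// => i ik.
by rewrite mxE (negbTE (ik : (i : nat) != k)) mulr0.
Qed.

(** Since [J] annihilates the second component, each odd coordinate occurs at its own site only and
    can be eliminated site by site with [schur_complement]. *)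
Lemma S_restr_form (R : realType) (Om : Type) (T : Om -> Om)
  (f : Om -> 'M[R[i]]_2) (E : R) (w : Om) (N : nat) (x : 'rV[R[i]]_(N.*2)) :
  (forall w i j, f w j i = (f w i j)^*) -> (forall w, E - f22 f w != 0) ->
  let X k := (x *m (\col_(i < N.*2) ((i : nat) == k)%:R)) 0 0 in
  let om j := iter j.+1 T w in
  (x *m ((real_complex R E)%:M - S_restr T f w N) *m x ^t*) 0 0 =
  \sum_(j < N) real_complex R (E - f22 f (om j)) *
    `|X j.*2.+1 - f (om j) 0 1 / real_complex R (E - f22 f (om j)) * X j.*2| ^+ 2
  + jacobi_form (fun j => aE f E (om j)) (fun j => X j.*2) N.
Proof.
move=> fsa e0 X om.
(* The matrix entries are extended to natural indices, so that sums can be split by parity. *)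
pose g k l := if k./2 == l./2 then f (om k./2) (Defs.comp k) (Defs.comp l)
    else if (k./2 == (l./2).+1) || (l./2 == (k./2).+1) then
      (if ~~ odd k && ~~ odd l then 1 else 0)
    else 0.
have -> : (x *m ((real_complex R E)%:M - S_restr T f w N) *m x ^t*) 0 0 =
    real_complex R E * (\sum_(k < N.*2) X k * (X k)^*) -
    \sum_(k < N.*2) \sum_(l < N.*2) X k * g k l * (X l)^*.
  rewrite mulmxBr mul_mx_scalar mulmxBl -scalemxAl mxE [X in X + _]mxE.
  rewrite [X in _ + X]mxE; congr (_ * _ - _).
    by rewrite mxE; apply: eq_bigr => k _; rewrite !mxE /X pairing_site.
  rewrite exchange_big mxE; apply: eq_bigr => l _.
  rewrite mxE mulr_suml; apply: eq_bigr => k _.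
  by rewrite !mxE /X !pairing_site.
pose u j := X j.*2; pose v j := X j.*2.+1.
rewrite (big_ord_double (fun k => X k * (X k)^*)).
rewrite (big_ord_double (fun k => \sum_(l < N.*2) X k * g k l * (X l)^*)).
have -> : \sum_(i < N) (\sum_(l < N.*2) X i.*2 * g i.*2 l * (X l)^* +
      \sum_(l < N.*2) X i.*2.+1 * g i.*2.+1 l * (X l)^*) =
   \sum_(i < N) \sum_(j < N)
    (if i == j :> nat then
       u i * f (om i) 0 0 * (u i)^* + u i * f (om i) 0 1 * (v i)^* +
       (v i * f (om i) 1 0 * (u i)^* + v i * f (om i) 1 1 * (v i)^*)
     else if ((i : nat) == j.+1) || ((j : nat) == i.+1) then u i * (u j)^* else 0).
  apply: eq_bigr => i _.
  rewrite (big_ord_double (fun l => X i.*2 * g i.*2 l * (X l)^*)).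
  rewrite (big_ord_double (fun l => X i.*2.+1 * g i.*2.+1 l * (X l)^*)).
  rewrite -big_split /=; apply: eq_bigr => j _.
  have [ci di] := compE i; have [cj dj] := compE j.
  rewrite /g /= !uphalf_double !doubleK !odd_double /= ci di cj dj.
  case: eqP => [->//|_]; case: ifP => _; last by rewrite !(mulr0, mul0r, addr0).
  by rewrite !(mulr0, mul0r, addr0, mulr1).
rewrite (big_tridiagonal (fun i => u i * f (om i) 0 0 * (u i)^* +
  u i * f (om i) 0 1 * (v i)^* +
  (v i * f (om i) 1 0 * (u i)^* + v i * f (om i) 1 1 * (v i)^*))
  (fun i j => u i * (u j)^*)).
rewrite /jacobi_form opprD !addrA; congr (_ - _).
rewrite mulr_sumr -sumrB -big_split /=; apply: eq_bigr => j _.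
exact: schur_complement.
Qed.

(** The eliminated components contribute [sigma * N] nonnegative squares, so [N - npos A] equals
    [N + sigma * N] minus the eigenvalue count. *)
Lemma rot_lift_eig_count (R : realType) (Om : Type) (T : Om -> Om)
  (f : Om -> 'M[R[i]]_2) (E : R) (sigma : bool) (w : Om) (th : R) :
  (forall w i j, f w j i = (f w i j)^*) -> (forall w, E - f22 f w != 0) ->
  (forall w, (0 <= E - f22 f w) = sigma) ->
  exists B : R, forall N : nat,
    `|rot_lift_iter T (aE f E) N w th - th -
      (N%:R + sigma%:R * N%:R - (eig_count (S_restr T f w N) E)%:R) * pi| <= B.
Proof.
move=> fsa e0 esigma.
have [B HB] := rot_lift_iter_npos T (aE f E) w th.
exists B => N.
pose e k : 'cV[R[i]]_(N.*2) := \col_(i < N.*2) ((i : nat) == k)%:R.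
have [A [sA rA fA iA tA]] := HB N.*2 (fun j => e j.*2) N.
pose om j := iter j.+1 T w; pose d j := E - f22 f (om j).
pose c j := f (om j) 0 1 / real_complex R (d j).
pose sq j := (real_complex R (d j), e j.*2.+1 - c j *: e j.*2).
pose A' := [seq sq j | j <- iota 0 N].
have AA : eig_count (S_restr T f w N) E = npos (A' ++ A).
  apply: eig_countE.
  - exact: S_restr_hermitian.
  - rewrite /real_coefs all_cat -/(real_coefs A) rA andbT all_map.
    by apply/allP => j _ /=; rewrite complex_real eqxx.
  - by rewrite size_cat size_map size_iota sA addnn.
  - move=> x; rewrite S_restr_form// fA /diag_form big_cat big_map; congr (_ + _).
    rewrite -[in iota 0 N](subn0 N) -/(index_iota 0 N) big_mkord.
    by apply: eq_bigr => j _; rewrite pairingD pairingN pairingZ.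
  - move=> x; rewrite /vanish all_cat => /andP[/allP vA' vA].
    have u0 := iA x vA.
    have v0 j : (j < N)%N -> (x *m e j.*2.+1) 0 0 = 0.
      move=> jN; have /vA' : sq j \in A' by rewrite map_f// mem_iota.
      by rewrite /= pairingD pairingN pairingZ u0// mulr0 subr0 => /eqP.
    apply/rowP => k; rewrite [RHS]mxE -(pairing_site x k).
    have kN : (k./2 < N)%N by rewrite ltn_half_double.
    have := odd_double_half k; case: (odd k) => /= <-; first exact: v0.
    exact: u0.
have nA : npos (A' ++ A) = (sigma * N + npos A)%N.
  rewrite /npos count_cat count_map; congr (_ + _)%N.
  rewrite (eq_count (a2 := fun=> sigma)); last first.
    by move=> j /=; rewrite real_complex_ge0 esigma.
  by case: (sigma); rewrite ?count_predT ?count_pred0 ?size_iota ?mul1n.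
have -> : N%:R + sigma%:R * N%:R - (eig_count (S_restr T f w N) E)%:R =
    N%:R - (npos A)%:R :> R by rewrite AA nA natrD natrM; ring.
exact: tA.
Qed.

(** * Passage to the limit *)

Lemma cvg_bounded_divn (R : realType) (h : nat -> R) (B : R) :
  (forall n, `|h n| <= B) -> (fun n => h n / n%:R) @ \oo --> (0 : R).
Proof.
move=> hB; rewrite -(cvg_shiftS _ _) /=.
apply: (@squeeze_cvgr _ _ _ _ (fun n => - (B * harmonic n))
  (fun n => B * harmonic n)).
- apply: nearW => n; rewrite -ler_norml normrM.
  rewrite [`|_^-1|]ger0_norm ?invr_ge0//.
  by rewrite ler_wpM2r// invr_ge0.
- rewrite -oppr0 -(mulr0 B); apply: cvgN; apply: cvgMr; exact: cvg_harmonic.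
- by rewrite -(mulr0 B); apply: cvgMr; exact: cvg_harmonic.
Qed.

Lemma rotation_number_IDS (R : realType) (Om : ptopologicalType)
  (nu : probability (borel Om) R) (T : Om -> Om)
  (f : Om -> 'M[R[i]]_2) (Nids : R -> R) (E : R) (sigma : bool) :
  is_IDS nu T f Nids ->
  (forall w i j, f w j i = (f w i j)^*) -> (forall w, E - f22 f w != 0) ->
  (forall w, (0 <= E - f22 f w) = sigma) ->
  is_fibered_rotation_number nu T (aE f E) ((1 + sigma%:R) / 2 - Nids E).
Proof.
move=> ids fsa e0 esigma; have := ids E; apply: filterS => w cw th.
have p0 := pi_gt0 R.
have [B HB] := rot_lift_eig_count T w th fsa e0 esigma.
pose h N := (rot_lift_iter T (aE f E) N w th - th -
  (N%:R + sigma%:R * N%:R - (eig_count (S_restr T f w N) E)%:R) * pi) / (2 * pi).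
have hB N : `|h N| <= B / (2 * pi).
  rewrite /h normrM [`|_^-1|]ger0_norm ?invr_ge0 ?mulr_ge0 ?(ltW p0)//.
  by rewrite ler_wpM2r ?invr_ge0 ?mulr_ge0 ?(ltW p0)// HB.
have hc := cvg_bounded_divn hB.
have : (fun N => h N / N%:R + ((1 + sigma%:R) / 2 -
    (eig_count (S_restr T f w N) E)%:R / (N.*2)%:R)) @ \oo
    --> 0 + ((1 + sigma%:R) / 2 - Nids E).
  by apply: cvgD => //; apply: cvgB => //; exact: cvg_cst.
rewrite add0r; apply: cvg_trans; apply: near_eq_cvg.
(* The two sequences agree only for [N > 0], since division by 0 gives 0. *)
near=> N; have N0 : (0 < N)%N by near: N; exact: nbhs_infty_gt.
rewrite /h; set c := (eig_count _ _)%:R; rewrite -muln2 natrM.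
(* [field] would otherwise unfold [pi]. *)
move: (lt0r_neq0 p0); move: (pi) => p pn0; field.
by rewrite pnatr_eq0 -lt0n N0.
Unshelve. all: by end_near. Qed.

(** Compactness makes the range bounded, so that [inf] and [sup] are genuine bounds rather than
    default values. *)
Lemma compact_range_bounds (R : realType) (Om : ptopologicalType)
  (g : Om -> R) (w : Om) :
  compact [set: Om] -> continuous g ->
  inf (range g) <= g w <= sup (range g).
Proof.
move=> cO cg.
have cr : compact (range g).
  by apply: continuous_compact => //; exact: continuous_subspaceT.
have rw : range g (g w) by exists w.
(* [compact_bounded] bounds the range by every number larger than [M], whence [M + 1]. *)
have [M [_ /(_ (M + 1))]] := compact_bounded cr.
rewrite ltrDl ltr01 => /(_ isT) bM.
apply/andP; split.
  apply: ge_inf => //; exists (- (M + 1)) => y /bM /=.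
  by rewrite ler_norml => /andP[].
apply: ub_le_sup => //; exists (M + 1) => y /bM /=.
by rewrite ler_norml => /andP[].
Qed.

Unset Implicit Arguments.
Set Strict Implicit.

Theorem theorem5p10 (R : realType) (Om : pseudoPMetricType R)
  (Om_hausdorff : hausdorff_space Om) (Om_compact : compact [set: Om])
  (T Tinv : Om -> Om)
  (TK : cancel T Tinv) (TinvK : cancel Tinv T)
  (T_cont : continuous T) (Tinv_cont : continuous Tinv)
  (nu : probability (borel Om) R)
  (nu_UE : uniquely_ergodic T nu)
  (f : Om -> 'M[R[i]]_2)
  (f_cont : forall i j : 'I_2,
     continuous (fun w : Om => complex.Re (f w i j)) /\
     continuous (fun w : Om => complex.Im (f w i j)))
  (f_selfadj : forall (w : Om) (i j : 'I_2), f w j i = (f w i j)^*)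
  (f_generic : {ae nu, forall w : borel Om,
     (forall k : int, f12 f (Tpow T Tinv k w) != 0) /\
     (forall k l : int, k != l ->
        f22 f (Tpow T Tinv k w) != f22 f (Tpow T Tinv l w))})
  (Nids : R -> R) (Nids_IDS : is_IDS nu T f Nids) :
  (forall E : R, sup (range (f22 f)) < E ->
     is_fibered_rotation_number nu T (aE f E) (1 - Nids E)) /\
  (forall E : R, E < inf (range (f22 f)) ->
     is_fibered_rotation_number nu T (aE f E) (2^-1 - Nids E)).
Proof.
have f22b w := compact_range_bounds w Om_compact (f_cont 1 1).1.
split => E hE.
  have e0 w : 0 < E - f22 f w.
    by rewrite subr_gt0 (le_lt_trans _ hE)//; case/andP: (f22b w).
  have -> : 1 - Nids E = (1 + true%:R) / 2 - Nids E by rewrite /=; field.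
  apply: rotation_number_IDS => // w; first by rewrite gt_eqF.
  by rewrite ltW.
have e0 w : E - f22 f w < 0.
  by rewrite subr_lt0 (lt_le_trans hE)//; case/andP: (f22b w).
have -> : 2^-1 - Nids E = (1 + false%:R) / 2 - Nids E by rewrite /=; field.
apply: rotation_number_IDS => // w; first by rewrite lt_eqF.
by rewrite leNgt e0.
Qed.
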